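(* There exist a dynamical system $(X,f)$ and three points $x_1,x_2,x_3\in X$ such that $x_2,x_3\in J_\alpha(x_1)$ for some ordinal $\alpha$ with $\alpha=\min\{\beta\mid x_2\in J_\beta(x_1)\}=\min\{\beta\mid x_3\in J_\beta(x_1)\}$, and $\Omega(x_1,x_2)\neq\Omega(x_1,x_3)$.
   Context: A dynamical system $(X,f)$ is a metric space $(X,d)$ with a continuous map $f:X\to X$. Write $x\,\mathcal{N}\,y$ if for every $\varepsilon>0$ there are $z\in B_\varepsilon(x)$ and an integer $k\ge1$ with $f^k(z)\in B_\varepsilon(y)$. The prolongational sets are defined by $J_1(x)=\{y\in X\mid x\,\mathcal{N}\,y\}$ and, for ordinals $\alpha>1$, $J_\alpha(x)=\bigcap_{\varepsilon>0}\overline{\bigcup_{n=1}^\infty\bigcup_{1\le\beta<\alpha}(J_\beta)^n(B_\varepsilon(x))}$, where $J_\beta(B)=\bigcup_{b\in B}J_\beta(b)$, $(J_\beta)^1=J_\beta$, $(J_\beta)^n=J_\beta((J_\beta)^{n-1})$. For $\varepsilon>0$, an $\varepsilon$-chain from $x$ to $y$ is a finite indexed sequence $C:x_0,\dots,x_m$ in $X$ with $m\ge1$, $x_0=x$, $x_m=y$, $d(f(x_i),x_{i+1})<\varepsilon$ for $0\le i<m$; its support is $\widehat C=\{x_0,\dots,x_m\}$. It is acyclic if $x_1,\dots,x_{m-1}$ are pairwise distinct and none equals $x_0$ or $x_m$ ($x_0=x_m$ is allowed). An acyclic chain $S_n$ induces on $\widehat{S_n}$ the relation $\le_n$: $u\le_n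 v$ iff $u=x_i,v=x_j$ for some $i\le j$ (a linear order on $\widehat{S_n}\setminus\{x,y\}$). A complete sequence of order-compatible nested chains from $x$ to $y$ is a sequence $\{S_n\}$ where $S_n$ is an acyclic $\varepsilon_n$-chain from $x$ to $y$ for some positive reals $\varepsilon_n$ converging monotonically to $0$, $\widehat{S_n}\subseteq\widehat{S_{n+1}}$, and $u\le_n v$ implies $u\le_{n+1}v$ for $u,v\in\widehat{S_n}$. With $S=\bigcup_n\widehat{S_n}$, the limit order on $S\setminus\{x,y\}$ is: $u\le_\infty v$ iff $u\le_n v$ for every $n$ with $u,v\in\widehat{S_n}$. The emergent order spectrum $\Omega(x,y)=\Omega_f(x,y)$ is the set of all order-types of $(S\setminus\{x,y\},\le_\infty)$ arising from complete sequences of order-compatible nested chains from $x$ to $y$ (empty if there are none). *)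

(* Defs.v *)
From HB Require Import structures.
From mathcomp Require Import all_boot all_order all_algebra.
From mathcomp Require Import all_classical all_reals all_analysis.

Set Implicit Arguments.
Unset Strict Implicit.
Unset Printing Implicit Defensive.

Import Order.TTheory GRing.Theory Num.Theory.
Import numFieldNormedType.Exports.
Local Open Scope classical_set_scope.
Local Open Scope ring_scope.

(* Ordinals as well-founded trees: [OSup u] is the least ordinal strictly above
   every [u i].  Distinct trees may denote the same ordinal: equality of
   ordinals is [ole] in both directions ([prolong_ext] shows that the
   prolongational sets do not distinguish equal ordinals). *)
Inductive ord : Type := OSup (A : Type) (u : A -> ord).

Fixpoint ole (a b : ord) : Prop :=
  match a, b with OSup _ u, OSup _ v => forall i, exists k, ole (u i) (v k) end.

Definition olt (a b : ord) : Prop :=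
  match b with OSup _ v => exists k, ole a (v k) end.

Definition ozero : ord := OSup (fun e : Empty_set => match e with end).
Definition osucc (a : ord) : ord := OSup (fun _ : unit => a).
Definition oone : ord := osucc ozero.

Definition is_omin (P : set ord) (a : ord) : Prop :=
  P a /\ forall b, P b -> ole a b.

Lemma ole_refl a : ole a a.
Proof. by elim: a => A u IH /= i; exists i. Qed.

Lemma ole_trans b a c : ole a b -> ole b c -> ole a c.
Proof.
elim: a b c => A u IH [B v] [C w] /= uv vw i.
have [k ik] := uv i; have [l kl] := vw k.
by exists l; exact: IH ik kl.
Qed.

Lemma olt_ole_trans b a c : olt a b -> ole b c -> olt a c.
Proof.
case: b c => B v [C w] [k ak] /(_ k)[l kl].
by exists l; exact: ole_trans ak kl.
Qed.

Lemma olt_wf : well_founded olt.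
Proof.
suff acc a : forall b, ole b a -> Acc olt b.
  by move=> a; exact: acc (ole_refl a).
elim: a => A u IH b bA; constructor => c /olt_ole_trans /(_ bA)[i ci].
exact: IH ci.
Qed.

Lemma olt_irrefl a : ~ olt a a.
Proof. by elim: (olt_wf a) => b _ IH bb; exact: (IH b bb bb). Qed.

Lemma ole_total a b : ole a b \/ olt b a.
Proof.
suff: (ole a b \/ olt b a) /\ (ole b a \/ olt a b) by case.
elim: a b => A u IHa; elim=> B v IHb; split.
  have [|nb] := pselect (exists i, ole (OSup v) (u i)); first by right.
  left=> i; have [_ [le|//]] := IHa i (OSup v).
  by exfalso; apply: nb; exists i.
have [|na] := pselect (exists k, ole (OSup u) (v k)); first by right.
left=> k; have [[le|//] _] := IHb k.
by exfalso; apply: na; exists k.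
Qed.

Section Prolongation.
Context {R : realType} {X : metricType R} (f : X -> X).

Definition prolong1 (x : X) : set X :=
  [set y | forall e : R, 0 < e ->
     exists z k, [/\ ball x e z, (1 <= k)%N & ball y e (iter k f z)]].

Definition img (g : X -> set X) (B : set X) : set X := \bigcup_(b in B) g b.

Definition prolong_step (a : ord) (J : forall b, olt b a -> X -> set X)
    (x : X) : set X :=
  if `[< ole a oone >] then prolong1 x
  else \bigcap_(e in [set e : R | 0 < e])
    closure (\bigcup_(n in [set n | (1 <= n)%N])
             \bigcup_(b in [set b : {b | olt b a} | ole oone (sval b)])
               iter n (img (J (sval b) (svalP b))) (ball x e)).

(* Meaningful for ordinals [a >= 1] only; see [prolong_1] and [prolong_gt1]
   for the two defining clauses. *)
Definition prolong : ord -> X -> set X :=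
  Fix olt_wf (fun _ => X -> set X) prolong_step.

Lemma prolongE a : prolong a = prolong_step (fun b (_ : olt b a) => prolong b).
Proof.
apply: (Fix_eq olt_wf (fun _ => X -> set X) prolong_step) => {}a J K JK.
suff -> : J = K by [].
by apply: functional_extensionality_dep => b; apply/funext => ba.
Qed.

Lemma prolong_1 a : ole a oone -> prolong a = prolong1.
Proof.
by move=> a1; apply/funext => x; rewrite prolongE /prolong_step asboolT.
Qed.

Lemma prolong_gt1 a x : olt oone a ->
  prolong a x = \bigcap_(e in [set e : R | 0 < e])
    closure (\bigcup_(n in [set n | (1 <= n)%N])
             \bigcup_(b in [set b | ole oone b /\ olt b a])
               iter n (img (prolong b)) (ball x e)).
Proof.
move=> a1; rewrite prolongE /prolong_step asboolF; last first.
  by move=> /(olt_ole_trans a1)/olt_irrefl.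
apply: eq_bigcapr => e _; congr closure; apply: eq_bigcupr => n _.
apply/seteqP; split=> y.
  by case=> -[b ba] /= b1 yb; exists b.
by case=> b [b1 ba] yb; exists (exist _ b ba).
Qed.

Lemma prolong_ext a b : ole a b -> ole b a -> prolong a = prolong b.
Proof.
move=> ab ba; have [a1|a1] := ole_total a oone.
  by rewrite !prolong_1//; exact: ole_trans ba a1.
apply/funext => x; rewrite !prolong_gt1//; last exact: olt_ole_trans a1 ab.
suff -> : [set c | ole oone c /\ olt c a] = [set c | ole oone c /\ olt c b] by [].
by apply/seteqP; split=> c [c1 cl]; split=> //; apply: olt_ole_trans cl _.
Qed.

End Prolongation.

(* [Chain m p] is the indexed sequence p 0, ..., p m; the values of [p] beyond
   [m] are irrelevant. *)
Record chain (X : Type) := Chain { clen : nat; cpt :> nat -> X }.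

Definition support (X : Type) (C : chain X) : set X :=
  [set C i | i in [set i | (i <= clen C)%N]].

Definition acyclic (X : Type) (C : chain X) : Prop :=
  (forall i j, (0 < i < clen C)%N -> (0 < j < clen C)%N -> C i = C j -> i = j)
  /\ (forall i, (0 < i < clen C)%N -> C i <> C 0%N /\ C i <> C (clen C)).

Definition chain_le (X : Type) (C : chain X) (u v : X) : Prop :=
  exists i j, [/\ (i <= j)%N, (j <= clen C)%N, u = C i & v = C j].

Definition is_chain {R : realType} {X : metricType R} (f : X -> X) (e : R)
    (x y : X) (C : chain X) : Prop :=
  [/\ (1 <= clen C)%N, C 0%N = x, C (clen C) = y &
      forall i, (i < clen C)%N -> mdist (f (C i)) (C i.+1) < e].

Definition complete_nested {R : realType} {X : metricType R} (f : X -> X)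
    (x y : X) (S : nat -> chain X) : Prop :=
  (exists e : nat -> R,
     [/\ forall n, 0 < e n, nonincreasing_seq e, e @ \oo --> (0 : R) &
         forall n, is_chain f (e n) x y (S n)]) /\
  [/\ forall n, acyclic (S n),
      forall n, support (S n) `<=` support (S n.+1) &
      forall n u v, support (S n) u -> support (S n) v ->
        chain_le (S n) u v -> chain_le (S n.+1) u v].

Record linear_order := LinearOrder {
  lo_car :> Type;
  lo_le : lo_car -> lo_car -> Prop;
  lo_refl : forall u, lo_le u u;
  lo_anti : forall u v, lo_le u v -> lo_le v u -> u = v;
  lo_trans : forall u v w, lo_le u v -> lo_le v w -> lo_le u w;
  lo_total : forall u v, lo_le u v \/ lo_le v u
}.

Definition lo_iso (L M : linear_order) : Prop :=
  exists2 g : L -> M, bijective g & forall u v, lo_le u v <-> lo_le (g u) (g v).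

(* Classes of linear orders are plain predicates: using [set linear_order]
   would put the universe of [linear_order] strictly below that of [set], so
   that [limit_car] could not be a carrier. *)
Definition order_class := linear_order -> Prop.

Definition order_type (L : linear_order) : order_class := fun M => lo_iso L M.

Definition limit_le (X : Type) (S : nat -> chain X) (u v : X) : Prop :=
  forall n, support (S n) u -> support (S n) v -> chain_le (S n) u v.

Section LimitOrder.
Context {R : realType} {X : metricType R} (f : X -> X) (x y : X).
Variable S : nat -> chain X.
Hypothesis cS : complete_nested f x y S.

Definition limit_car : set X := \bigcup_n support (S n) `\` [set x; y].

Let le (u v : limit_car) : Prop := limit_le S (\val u) (\val v).

Let supS m n : (m <= n)%N -> support (S m) `<=` support (S n).
Proof.
have [_ [_ ss _]] := cS; move=> /subnK <-; elim: (n - m)%N => // k IH.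
exact: subset_trans IH (ss _).
Qed.

Let leS m n u v : (m <= n)%N -> support (S m) u -> support (S m) v ->
  chain_le (S m) u v -> chain_le (S n) u v.
Proof.
have [_ [_ _ oc]] := cS; move=> /subnK <- um vm uv; elim: (n - m)%N => // k IH.
by apply: oc => //; [apply: supS um|apply: supS vm]; exact: leq_addl.
Qed.

Let inner n w k : ~ [set x; y] w -> w = S n k -> (k <= clen (S n))%N ->
  (0 < k < clen (S n))%N.
Proof.
have [[e [_ _ _ ch]] _] := cS; have [_ n0 nm _] := ch n.
move=> nw wk km; rewrite lt0n ltn_neqAle km andbT.
apply/andP; split; apply/eqP => ke.
  by apply: nw; left; rewrite wk ke.
by apply: nw; right; rewrite wk ke.
Qed.

Let innerI n w i j : ~ [set x; y] w -> (i <= clen (S n))%N ->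
  (j <= clen (S n))%N -> w = S n i -> w = S n j -> i = j.
Proof.
have [_ [ac _ _]] := cS; have [inj _] := ac n; move=> nw im jm wi wj.
by apply: inj; [exact: inner wi im|exact: inner wj jm|rewrite -wi -wj].
Qed.

Let anti n u v : ~ [set x; y] u -> ~ [set x; y] v ->
  chain_le (S n) u v -> chain_le (S n) v u -> u = v.
Proof.
move=> nu nv [i [j [ij jm ui vj]]] [k [l [kl lm vk ul]]].
have il := innerI nu (leq_trans ij jm) lm ui ul.
have jk := innerI nv jm (leq_trans kl lm) vj vk.
by rewrite ui vj; congr (S n _); apply/eqP; rewrite eqn_leq ij il jk kl.
Qed.

Let ctrans n u v w : ~ [set x; y] v ->
  chain_le (S n) u v -> chain_le (S n) v w -> chain_le (S n) u w.
Proof.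
move=> nv [i [j [ij jm ui vj]]] [k [l [kl lm vk wl]]].
have jk := innerI nv jm (leq_trans kl lm) vj vk.
by exists i, l; split=> //; apply: leq_trans ij _; rewrite jk.
Qed.

Let tot n u v : support (S n) u -> support (S n) v ->
  chain_le (S n) u v \/ chain_le (S n) v u.
Proof.
move=> [i /= im <-] [j /= jm <-].
have [ij|/ltnW ji] := leqP i j; [left; exists i, j|right; exists j, i]; split=> //.
Qed.

Let carP (u : limit_car) :
  (exists n, support (S n) (\val u)) /\ ~ [set x; y] (\val u).
Proof. by have /set_mem[[n _ un] nu] := valP u; split=> //; exists n. Qed.

Let le_of n (u v : limit_car) : support (S n) (\val u) ->
  support (S n) (\val v) -> chain_le (S n) (\val u) (\val v) -> le u v.
Proof.
move=> un vn uv m um vm; have [nm|/ltnW mn] := leqP n m.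
  exact: leS nm un vn uv.
have [//|vu] := tot um vm.
have [_ nu] := carP u; have [_ nv] := carP v.
have -> : \val u = \val v := anti nu nv uv (leS mn vm um vu).
by case: vm => i im <-; exists i, i; split.
Qed.

Let le_refl u : le u u.
Proof. by move=> n _ [i im <-]; exists i, i; split. Qed.

Let le_anti u v : le u v -> le v u -> u = v.
Proof.
have [[n un] nu] := carP u; have [[m vm] nv] := carP v.
have un' := supS (leq_maxl n m) un; have vn' := supS (leq_maxr n m) vm.
move=> uv vu; apply: val_inj.
exact: (@anti (maxn n m)) nu nv (uv _ un' vn') (vu _ vn' un').
Qed.

Let le_total u v : le u v \/ le v u.
Proof.
have [[n un] nu] := carP u; have [[m vm] nv] := carP v.
have un' := supS (leq_maxl n m) un; have vn' := supS (leq_maxr n m) vm.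
have [uv|vu] := tot un' vn'; [left; exact: le_of uv|right; exact: le_of vu].
Qed.

Let le_trans u v w : le u v -> le v w -> le u w.
Proof.
move=> uv vw; have [[n un] nu] := carP u; have [[m vm] nv] := carP v.
have [[k wk] nw] := carP w; pose N := maxn n (maxn m k).
have un' : support (S N) (\val u) by apply: supS un; rewrite leq_maxl.
have vn' : support (S N) (\val v).
  by apply: supS vm; rewrite /N maxnCA leq_maxl.
have wn' : support (S N) (\val w).
  by apply: supS wk; rewrite /N maxnA leq_maxr.
apply: (le_of un' wn').
exact: ctrans nv (uv _ un' vn') (vw _ vn' wn').
Qed.

Definition limit_order : linear_order :=
  @LinearOrder limit_car le le_refl le_anti le_trans le_total.

End LimitOrder.

Definition Omega {R : realType} {X : metricType R} (f : X -> X) (x y : X) :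
    order_class -> Prop :=
  fun T => exists S (cS : complete_nested f x y S),
    T = order_type (limit_order cS).

(* Main.v *)
(** On the line with the translation x |-> x + 1, take x1 = 0, x2 = 1, x3 = 2.
    Both x2 and x3 lie on the forward orbit of x1, so alpha = 1.  The one-step
    chain 0, 1 puts the empty order in Omega(0, 1).  The empty order is not in
    Omega(0, 2): a chain from 0 to 2 without interior points jumps from
    f 0 = 1 to 2, which is an e-chain only for e > 1. *)

Require Import Defs.
From HB Require Import structures.
From mathcomp Require Import all_boot all_order all_algebra.
From mathcomp Require Import all_classical all_reals all_analysis.
Import numFieldNormedType.Exports.
Local Open Scope classical_set_scope.
Local Open Scope ring_scope.
Import Order.TTheory GRing.Theory Num.Theory.

Lemma lo_iso_refl (L : linear_order) : lo_iso L L.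
Proof. by exists id => //; exists id. Qed.

Lemma prolong1_iter (R : realType) (X : metricType R) (f : X -> X) (x : X) k :
  (1 <= k)%N -> prolong1 f x (iter k f x).
Proof. by move=> k1 e e0; exists x, k; split => //; exact: ballxx. Qed.

(** Minimality is immediate: the candidate ordinals are restricted to those at least [oone], and
    [prolong f oone] is [prolong1 f]. *)
Lemma is_omin_oone (R : realType) (X : metricType R) (f : X -> X) (x y : X) :
  prolong1 f x y ->
  is_omin [set b | ole oone b /\ prolong f b x y] oone.
Proof.
move=> xy; split=> [|b []//].
by rewrite /= (prolong_1 f (ole_refl oone)); split=> //; exact: ole_refl.
Qed.

(** A constant sequence is trivially nested and order-compatible. The single jump has error 0, so it
    is an e-chain for every e > 0, and any positive sequence decreasing to 0 serves as
    tolerances. *)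
Lemma complete_nested_step (R : realType) (X : metricType R) (f : X -> X)
    (x : X) :
  complete_nested f x (f x) (fun=> Chain 1 (fun i => iter i f x)).
Proof.
split; last first.
  by split=> [_|_ u //|//]; split=> [i j|i]; case: i => [|[|i]].
exists harmonic; split.
- by move=> n; exact: harmonic_gt0.
- by move=> m n mn; rewrite /harmonic /= lef_pV2 ?posrE// ler_nat.
- exact: cvg_harmonic.
- by move=> n; split=> // i _; rewrite mdistxx harmonic_gt0.
Qed.

Lemma limit_car_step (R : realType) (X : metricType R) (f : X -> X) (x : X) :
  limit_car x (f x) (fun=> Chain 1 (fun i => iter i f x)) = set0.
Proof.
rewrite -subset0 => u [[_ _ [i /= i1 <-]]]; apply.
by case: i i1 => [|[|i]] //= _; [left|right].
Qed.

(** Once the tolerance drops below the distance from [f x] to [y], a one-step chain is impossible;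
    the point of index 1 is then interior, and acyclicity keeps it away from both endpoints. *)
Lemma limit_car_neq0 (R : realType) (X : metricType R) (f : X -> X) (x y : X)
    (S : nat -> chain X) :
  f x <> y -> complete_nested f x y S -> limit_car x y S !=set0.
Proof.
move=> fxy [[e [_ _ e0 ch]] [ac _ _]].
have d0 : 0 < mdist (f x) y by rewrite mdist_gt0; exact/eqP.
have [n _ en] : \forall n \near \oo, e n < mdist (f x) y.
  exact: cvgr_lt e0 _ d0.
have {}en := en n (leqnn n).
have [m1 S0 Sm Sd] := ch n; have [_ acn] := ac n.
have m2 : (1 < clen (S n))%N.
  rewrite ltn_neqAle m1 andbT; apply/eqP => m_eq; rewrite -m_eq in Sm.
  by have := Sd 0%N m1; rewrite S0 Sm => /(lt_trans en); rewrite ltxx.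
have [h0 hm] := acn 1%N m2.
exists (S n 1%N); split; first by exists n => //; exists 1%N.
by case=> /= h; [apply: h0; rewrite S0|apply: hm; rewrite Sm].
Qed.

Theorem theorem6p6 (R : realType) :
  exists (X : metricType R) (f : X -> X) (x1 x2 x3 : X),
    [/\ continuous f,
        [/\ x1 <> x2, x1 <> x3 & x2 <> x3],
        exists a : ord,
          [/\ prolong f a x1 x2, prolong f a x1 x3,
              is_omin [set b | ole oone b /\ prolong f b x1 x2] a &
              is_omin [set b | ole oone b /\ prolong f b x1 x3] a] &
        Omega f x1 x2 <> Omega f x1 x3].
Proof.
pose f (x : R^o) : R^o := x + 1.
have f_lt x : x < f x by rewrite ltrDl.
have fx_neq x : x <> f x by apply/eqP; rewrite lt_eqF.
exists R^o, f, 0, (f 0), (f (f 0)); split.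
- by move=> x; apply: cvgD; [exact: cvg_id|exact: cvg_cst].
- by split=> //; apply/eqP; rewrite lt_eqF// (lt_trans (f_lt 0)).
- have J2 : prolong1 f 0 (f 0) by exact: (@prolong1_iter _ R^o f 0 1).
  have J3 : prolong1 f 0 (f (f 0)) by exact: (@prolong1_iter _ R^o f 0 2).
  exists oone.
  by rewrite (prolong_1 f (ole_refl oone)); split=> //; exact: is_omin_oone.
- move=> Omega_eq.
  have cS := @complete_nested_step _ R^o f 0.
  have : Omega f 0 (f 0) (order_type (limit_order cS)) by exists _, cS.
  rewrite Omega_eq => -[S [cS' LL']].
  (* Equal order-types are equal classes; since the second class contains its own representative,
     the two limit orders are isomorphic. *)
  have [g [h _ _] _] : order_type (limit_order cS) (limit_order cS').
    by rewrite LL'; exact: lo_iso_refl.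
  have [u Su] := limit_car_neq0 _ _ _ _ _ _ (@fx_neq (f 0)) cS'.
  (* The inverse bijection [h] would send the interior point [u] into the empty carrier. *)
  case: (h (SigSub (mem_set Su))) => v /set_mem.
  by rewrite limit_car_step.
Qed.
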